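(* Let $f$ be a strictly monotone continuous function having, as $x\to\infty$, the asymptotic expansion $$f(x)\sim x^u\sum_{n=0}^\infty b_nx^{-n},$$ where $u\ne0$ is a real number and $b_0\neq0$, and let $s<t$ be real numbers. Then the integral mean of $f$ has the asymptotic expansion, as $x\to\infty$, $$I_f(x+s,x+t)\sim x\sum_{n=0}^\infty a_nx^{-n},$$ and the coefficients $a_n$ satisfy the following recursive relation: $a_0=1$ and, for $n\ge1$, $$a_n=-\frac1{b_0u}\left(\sum_{j=1}^n b_jP_{n-j}(u-j)+\frac{b_0}{n}\sum_{k=1}^{n-1}\bigl(k(1+u)-n\bigr)a_kP_{n-k}(u)-c_n\right),$$ where, for real $r$, $P_0(r)=a_0^r$ and $P_n(r)=\frac1{na_0}\sum_{k=1}^n[k(1+r)-n]\,a_k\,P_{n-k}(r)$ for $n\ge1$, and $$c_n=\sum_{k=0}^n\frac{b_k}{n+1-k}\binom{u-k}{n-k}\frac{t^{n+1-k}-s^{n+1-k}}{t-s}.$$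
   Context: For a strictly monotone continuous function $f$ and $s\ne t$ in its domain interval, the integral $f$-mean of $s$ and $t$ is $$I_f(s,t)=f^{-1}\left(\frac1{t-s}\int_s^tf(z)\,dz\right),$$ i.e. the unique $\vartheta$ between $s$ and $t$ with $\frac1{t-s}\int_s^tf(z)\,dz=f(\vartheta)$. Here $f$ is defined on an interval containing all sufficiently large $x$, so that $I_f(x+s,x+t)$ is defined for large $x$. The binomial coefficients are generalized: $\binom{r}{m}=\frac{r(r-1)\cdots(r-m+1)}{m!}$ for real $r$ and integer $m\ge0$. *)

(* Defs.v *)
From Stdlib Require Import Reals Factorial.
From Coquelicot Require Import Coquelicot.
Open Scope R_scope.

Definition is_interval (D : R -> Prop) : Prop :=
  forall x y z : R, D x -> D y -> x <= z <= y -> D z.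

Definition strictly_monotone_on (D : R -> Prop) (f : R -> R) : Prop :=
  (forall x y : R, D x -> D y -> x < y -> f x < f y) \/
  (forall x y : R, D x -> D y -> x < y -> f y < f x).

(* The inverse of [f] restricted to [D]; the value is meaningful only at the
   points [y] having exactly one preimage in [D]. *)
Definition inverse_on (D : R -> Prop) (f : R -> R) (y : R) : R :=
  iota (fun x : R => D x /\ f x = y).

Definition integral_mean (D : R -> Prop) (f : R -> R) (s t : R) : R :=
  inverse_on D f (/ (t - s) * RInt f s t).

(* [g x ~ phi x * sum_n c_n x^(-n)] as [x -> +oo], in the sense of Poincare:
   truncating after the term of index [N] leaves an error [o(phi x * x^(-N))].
   In [is_domin F h g] it is [g] that is negligible with respect to [h]. *)
Definition asymptotic_expansion
    (g phi : R -> R) (c : nat -> R) : Prop :=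
  forall N : nat,
    is_domin (Rbar_locally p_infty)
      (fun x : R => phi x * / x ^ N)
      (fun x : R => g x - phi x * sum_n (fun n => c n * / x ^ n) N).

Fixpoint falling_factorial (r : R) (m : nat) : R :=
  match m with
  | O => 1
  | S m' => falling_factorial r m' * (r - INR m')
  end.

Definition gbinomial (r : R) (m : nat) : R :=
  falling_factorial r m / INR (fact m).

(* [P n r] is the coefficient of [x^(-n)] in the [r]-th power of the series
   [sum_n a_n x^(-n)]; for [a 0 > 0] the two equations determine [P]. *)
Definition power_coefficients (a : nat -> R) (P : nat -> R -> R) : Prop :=
  forall r : R,
    P 0%nat r = Rpower (a 0%nat) r /\
    forall n : nat, (1 <= n)%nat ->
      P n r =
        1 / (INR n * a 0%nat) *
        sum_n_m (fun k => (INR k * (1 + r) - INR n) * a k * P (n - k)%nat r)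
          1 n.

Definition mean_coefficient (u : R) (b : nat -> R) (s t : R) (n : nat) : R :=
  sum_n (fun k =>
      b k / INR (n + 1 - k) * gbinomial (u - INR k) (n - k) *
      ((t ^ (n + 1 - k) - s ^ (n + 1 - k)) / (t - s)))
    n.

(* Main.v *)
Require Import Defs.
From Stdlib Require Import Reals Factorial Lra Lia.
From Coquelicot Require Import Coquelicot.
Open Scope R_scope.

(** Write [w] for [1/x], so that an expansion in powers of [x^(-n)] truncated
    at order [N] is the polynomial [poly c N w].

    The mean value [theta = I_f(x+s,x+t)] lies in [[x+s,x+t]] and satisfies
    [f theta = F x], where [F x] is the mean of [f] over that interval.  Both
    sides are expanded by one principle, [expansion_at_scaled_point]: if every
    real power [v^r] has an expansion in [w] with coefficients [p_m(r)], then
    [f (x v)] has the expansion [x^u sum_n q_n w^n], where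
    [q_n = sum_(k<=n) b_k p_(n-k)(u-k)].
    - With [v = 1 + z w] the [p_m(r)] are [binom(r,m) z^m]; the error is uniform
      in bounded [z], so integrating over [z] from [s] to [t] gives [F] the
      coefficients [c_n] ([mean_expansion]).
    - With [v = sum_(n<=N) a_n w^n] the [p_m(r)] are the [P_m(r)], and the
      recursion for [a_n] says exactly that [q_n = c_n]
      ([composition_coefficient]).

    Hence [f theta] and [f (x v)] differ by [o(x^(u-N))].  As [f] is only
    continuous, the mean value theorem is applied to its truncated expansion,
    whose derivative is asymptotic to [u b_0 x^(u-1)].  It gives
    [theta - x v = o(x^(1-N))] ([close_values_imply_close_points]), which is
    the claim.

    The expansion of [S^r] for a polynomial [S] with [S(0) = 1]
    ([real_power_of_polynomial]) comes from a differential equation.  The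
    recursion for the [P_n(r)] says that [Q = sum_(n<=N) P_n(r) w^n] satisfies
    the equation [S Q' = r S' Q] of [S^r] up to [O(w^N)].  Hence
    [(Q S^(-r))' = O(w^N)], and [Q S^(-r) = 1 + O(w^(N+1))].  The binomial
    series is the case [S = 1 + w]. *)

(** * Finite sums of real numbers *)

(** A sum built with [sum_n] is typed in the carrier of an abstract structure;
    [real_eq] exposes it as [R] for [ring] and [field].  For the same reason
    the next lemmas restate general facts about [sum_n] with the operations
    of [R]. *)
Ltac real_eq := match goal with |- @eq _ ?a ?b => change (@eq R a b) end.

Lemma sum_n_S (c : nat -> R) (n : nat) :
  sum_n c (S n) = sum_n c n + c (S n).
Proof. exact (sum_Sn c n). Qed.

Lemma sum_n_0 (c : nat -> R) : sum_n c 0 = c 0%nat.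
Proof. exact (sum_O c). Qed.

Lemma sum_n_eq (c d : nat -> R) (n : nat) :
  (forall k, (k <= n)%nat -> c k = d k) -> sum_n c n = sum_n d n.
Proof. exact (sum_n_ext_loc c d n). Qed.

Lemma sum_n_scal_l (x : R) (c : nat -> R) (n : nat) :
  sum_n (fun k => x * c k) n = x * sum_n c n.
Proof. exact (sum_n_mult_l x c n). Qed.

Lemma sum_n_add (c d : nat -> R) (n : nat) :
  sum_n (fun k => c k + d k) n = sum_n c n + sum_n d n.
Proof. exact (sum_n_plus c d n). Qed.

Lemma sum_n_split_first (c : nat -> R) (n : nat) :
  sum_n c n = c 0%nat + sum_n_m c 1 n.
Proof. unfold sum_n; rewrite sum_Sn_m; [reflexivity | lia]. Qed.

Lemma sum_n_abs_le (c d : nat -> R) (n : nat) :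
  (forall k, (k <= n)%nat -> Rabs (c k) <= d k) ->
  Rabs (sum_n c n) <= sum_n d n.
Proof.
induction n as [|n IH]; intros H.
- rewrite !sum_n_0; apply H; lia.
- rewrite !sum_n_S.
  eapply Rle_trans; [apply Rabs_triang|].
  apply Rplus_le_compat; [apply IH; intros; apply H; lia | apply H; lia].
Qed.

Lemma sum_n_abs_nonneg (c : nat -> R) (n : nat) :
  0 <= sum_n (fun k => Rabs (c k)) n.
Proof.
eapply Rle_trans; [apply (Rabs_pos (sum_n c n))|].
apply sum_n_abs_le; intros; lra.
Qed.

Lemma triangular_sum (g : nat -> nat -> R) (N : nat) :
  sum_n (fun k => sum_n (g k) (N - k)) N =
  sum_n (fun n => sum_n (fun k => g k (n - k)%nat) n) N.
Proof.
induction N as [|N IH]; [now rewrite !sum_n_0|].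
rewrite sum_n_S, (sum_n_S _ N), <- IH, Nat.sub_diag, sum_n_0.
rewrite (sum_n_eq _
  (fun k => sum_n (g k) (N - k) + g k (S N - k)%nat)).
- rewrite sum_n_add, (sum_n_S _ N), Nat.sub_diag; real_eq; ring.
- intros k Hk; replace (S N - k)%nat with (S (N - k)) by lia; apply sum_n_S.
Qed.

(** * Truncated power series *)

Definition poly (c : nat -> R) (N : nat) (w : R) : R :=
  sum_n (fun k => c k * w ^ k) N.

Lemma poly_S (c : nat -> R) (N : nat) (w : R) :
  poly c (S N) w = poly c N w + c (S N) * w ^ S N.
Proof. apply sum_n_S. Qed.

Lemma poly_scal (r : R) (c : nat -> R) (N : nat) (w : R) :
  poly (fun n => r * c n) N w = r * poly c N w.
Proof.
unfold poly; rewrite <- sum_n_scal_l; apply sum_n_eq; intros; real_eq; ring.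
Qed.

Lemma poly_0 (c : nat -> R) (w : R) : poly c 0 w = c 0%nat.
Proof. unfold poly; rewrite sum_n_0; simpl; ring. Qed.

Lemma poly_at_0 (c : nat -> R) (N : nat) : poly c N 0 = c 0%nat.
Proof.
induction N as [|N IH]; [apply poly_0|].
rewrite poly_S, IH; simpl; ring.
Qed.

Lemma poly_ext (c d : nat -> R) (N : nat) (w : R) :
  (forall n, (n <= N)%nat -> c n = d n) -> poly c N w = poly d N w.
Proof.
intros H; apply sum_n_eq; intros n Hn; now rewrite H.
Qed.

Lemma pow_abs_le (w : R) (m n : nat) :
  Rabs w <= 1 -> (m <= n)%nat -> Rabs w ^ n <= Rabs w ^ m.
Proof.
intros Hw Hmn; replace n with (m + (n - m))%nat by lia.
rewrite pow_add; rewrite <- (Rmult_1_r (Rabs w ^ m)) at 2.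
apply Rmult_le_compat_l; [apply pow_le, Rabs_pos|].
rewrite <- (pow1 (n - m)); apply pow_incr; split; [apply Rabs_pos | easy].
Qed.

(** The constant is independent of the order [M] of truncation, so that it
    serves all the orders [N - k] of a Cauchy product at once. *)
Lemma poly_truncation (c : nat -> R) (M N : nat) (w : R) :
  (M <= N)%nat -> Rabs w <= 1 ->
  Rabs (poly c N w - poly c M w)
  <= sum_n (fun k => Rabs (c k)) N * Rabs w ^ S M.
Proof.
intros HMN Hw; induction HMN as [|N HMN IH].
- rewrite Rminus_diag, Rabs_R0.
  apply Rmult_le_pos; [apply sum_n_abs_nonneg | apply pow_le, Rabs_pos].
- rewrite poly_S, sum_n_S.
  replace (poly c N w + c (S N) * w ^ S N - poly c M w)
    with ((poly c N w - poly c M w) + c (S N) * w ^ S N) by ring.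
  eapply Rle_trans; [apply Rabs_triang|].
  rewrite Rmult_plus_distr_r, Rabs_mult, <- RPow_abs.
  apply Rplus_le_compat; [easy|].
  apply Rmult_le_compat_l; [apply Rabs_pos | apply pow_abs_le; [easy | lia]].
Qed.

Lemma poly_near_constant_term (c : nat -> R) (N : nat) (eps : R) :
  0 < eps ->
  exists delta, 0 < delta <= 1 /\ forall w, Rabs w <= delta ->
    Rabs (poly c N w - c 0%nat) <= eps.
Proof.
intros Heps.
assert (H := fun w => poly_truncation c 0 N w (Nat.le_0_l N)).
set (C := sum_n (fun k => Rabs (c k)) N) in H.
assert (HC : 0 <= C) by apply sum_n_abs_nonneg.
assert (Hq : 0 < eps / (C + 1)) by (apply Rdiv_lt_0_compat; lra).
exists (Rmin 1 (eps / (C + 1))); split.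
- split; [apply Rmin_pos; lra | apply Rmin_l].
- intros w Hw.
  assert (H1 := Rmin_l 1 (eps / (C + 1))); assert (H2 := Rmin_r 1 (eps / (C + 1))).
  rewrite <- (poly_0 c w).
  eapply Rle_trans; [apply H; lra|].
  rewrite pow_1.
  apply Rle_trans with ((C + 1) * (eps / (C + 1))).
  + apply Rmult_le_compat; try lra; apply Rabs_pos.
  + right; field; lra.
Qed.

(** The factor [w^k] lowers the accuracy needed from [g k]: order [N - k] is
    enough.  Both the product of two polynomials and the composition of two
    asymptotic expansions are instances. *)
Lemma combination_of_expansions
    (c : nat -> R) (d : nat -> nat -> R) (C : R) (g : nat -> R)
    (N : nat) (w : R) :
  (forall k, (k <= N)%nat ->
     Rabs (g k - poly (d k) (N - k) w) <= C * Rabs w ^ S (N - k)) ->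
  Rabs (sum_n (fun k => c k * w ^ k * g k) N -
        poly (fun n => sum_n (fun k => c k * d k (n - k)%nat) n) N w)
  <= sum_n (fun k => Rabs (c k)) N * C * Rabs w ^ S N.
Proof.
intros H.
assert (E : poly (fun n => sum_n (fun k => c k * d k (n - k)%nat) n) N w =
            sum_n (fun k => c k * w ^ k * poly (d k) (N - k) w) N).
{ unfold poly at 1.
  rewrite (sum_n_eq (fun k => c k * w ^ k * poly (d k) (N - k) w)
    (fun k => sum_n (fun m => c k * w ^ k * (d k m * w ^ m)) (N - k))).
  - rewrite (triangular_sum (fun k m => c k * w ^ k * (d k m * w ^ m))).
    apply sum_n_eq; intros n _; rewrite Rmult_comm, <- sum_n_scal_l.
    apply sum_n_eq; intros k Hk.
    replace (w ^ n) with (w ^ k * w ^ (n - k))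
      by (rewrite <- pow_add; f_equal; lia); ring.
  - intros k _; unfold poly; now rewrite <- sum_n_scal_l. }
rewrite E; clear E.
replace (_ - _) with
  (sum_n (fun k => c k * w ^ k * (g k - poly (d k) (N - k) w)) N).
2: { assert (E : forall x y : R, x - y = x + (-1) * y) by (intros; ring).
     rewrite E, <- sum_n_scal_l, <- sum_n_add; apply sum_n_eq.
     intros k _; ring. }
rewrite Rmult_assoc, Rmult_comm, <- sum_n_scal_l.
apply sum_n_abs_le; intros k Hk.
rewrite !Rabs_mult, <- RPow_abs.
apply Rle_trans with (Rabs (c k) * Rabs w ^ k * (C * Rabs w ^ S (N - k))).
- apply Rmult_le_compat_l; [|now apply H].
  apply Rmult_le_pos; [apply Rabs_pos | apply pow_le, Rabs_pos].
- right; replace (S N) with (k + S (N - k))%nat by lia; rewrite pow_add; ring.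
Qed.

Lemma poly_product (c d : nat -> R) (N : nat) (w : R) :
  Rabs w <= 1 ->
  Rabs (poly c N w * poly d N w -
        poly (fun n => sum_n (fun k => c k * d (n - k)%nat) n) N w)
  <= sum_n (fun k => Rabs (c k)) N * sum_n (fun k => Rabs (d k)) N *
     Rabs w ^ S N.
Proof.
intros Hw.
replace (poly c N w * poly d N w)
  with (sum_n (fun k => c k * w ^ k * poly d N w) N).
- apply (combination_of_expansions c (fun _ => d)); intros k Hk.
  apply poly_truncation; [lia | easy].
- unfold poly at 2; rewrite (Rmult_comm (sum_n _ N)), <- sum_n_scal_l.
  apply sum_n_eq; intros k _; real_eq; ring.
Qed.

(** * Real powers of a polynomial *)

Lemma exp_le (x y : R) : x <= y -> exp x <= exp y.
Proof.
intros [H | ->]; [left; now apply exp_increasing | apply Rle_refl].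
Qed.

Lemma Rpower_bounds (r v : R) :
  / 2 <= v <= 2 -> Rpower 2 (- Rabs r) <= Rpower v r <= Rpower 2 (Rabs r).
Proof.
intros [H1 H2]; unfold Rpower.
assert (L1 : ln v <= ln 2) by (apply ln_le; lra).
assert (L2 : - ln 2 <= ln v) by (rewrite <- ln_Rinv by lra; apply ln_le; lra).
assert (Hv : Rabs (ln v) <= ln 2) by (apply Rabs_le; lra).
assert (H : Rabs (r * ln v) <= Rabs r * ln 2).
{ rewrite Rabs_mult; apply Rmult_le_compat_l; [apply Rabs_pos | easy]. }
apply Rabs_le_between in H.
split; apply exp_le; lra.
Qed.

Lemma Rpower_minus_INR (v r : R) (n : nat) :
  0 < v -> Rpower v (r - INR n) = Rpower v r * (/ v) ^ n.
Proof.
intros Hv; unfold Rminus; rewrite Rpower_plus, Rpower_Ropp, Rpower_pow by easy.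
now rewrite pow_inv.
Qed.

Definition poly_derivative (c : nat -> R) (N : nat) (w : R) : R :=
  sum_n (fun k => c k * (INR k * w ^ pred k)) N.

Lemma is_derive_poly (c : nat -> R) (N : nat) (w : R) :
  is_derive (poly c N) w (poly_derivative c N w).
Proof.
unfold poly_derivative; induction N as [|N IH].
- rewrite sum_n_0; apply (is_derive_ext (fun _ => c 0%nat)).
  + intros v; now rewrite poly_0.
  + auto_derive; [easy | simpl; ring].
- rewrite sum_n_S.
  apply (is_derive_ext (fun v => poly c N v + c (S N) * v ^ S N)).
  + intros v; now rewrite poly_S.
  + apply (is_derive_plus (poly c N)); [exact IH|].
    auto_derive; [easy |]; change (pred (S N)) with N; simpl; ring.
Qed.

(** The operator [w d/dw] multiplies the coefficient of [w^k] by [k] and does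
    not shift indices, unlike [d/dw]. *)
Lemma poly_derivative_euler (c : nat -> R) (N : nat) (w : R) :
  w * poly_derivative c N w = poly (fun k => INR k * c k) N w.
Proof.
unfold poly_derivative; rewrite <- sum_n_scal_l.
apply sum_n_eq; intros [|k] _; simpl; ring.
Qed.

(** The derivative is bounded only away from [0], after multiplication by [w].
    This suffices because the mean value theorem gives a point strictly
    between [0] and [w]. *)
Lemma growth_from_derivative (h dh : R -> R) (delta K : R) (N : nat) :
  (forall w, Rabs w <= delta -> is_derive h w (dh w)) ->
  (forall w, Rabs w <= delta -> Rabs (w * dh w) <= K * Rabs w ^ S N) ->
  0 <= K ->
  forall w, Rabs w <= delta -> Rabs (h w - h 0) <= K * Rabs w ^ S N.
Proof.
intros Hd Hb HK w Hw.
assert (H : forall c, c <> 0 -> Rabs c <= Rabs w ->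
  Rabs (dh c * w) <= K * Rabs w ^ S N).
{ intros c Hc Hcw.
  assert (Hc' := Rabs_pos_lt c Hc).
  assert (Hdc : Rabs (dh c) <= K * Rabs c ^ N).
  { apply (Rmult_le_reg_l (Rabs c)); [easy|].
    rewrite <- Rabs_mult; eapply Rle_trans; [apply Hb; lra|].
    simpl; right; ring. }
  rewrite Rabs_mult; simpl.
  apply Rle_trans with (K * Rabs c ^ N * Rabs w).
  - apply Rmult_le_compat_r; [apply Rabs_pos | easy].
  - rewrite Rmult_assoc; apply Rmult_le_compat_l; [easy|].
    rewrite Rmult_comm; apply Rmult_le_compat_l; [apply Rabs_pos|].
    apply pow_incr; split; [apply Rabs_pos | easy]. }
assert (Hd' : forall v, Rabs v <= Rabs w -> derivable_pt_lim h v (dh v)).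
{ intros v Hv; apply is_derive_Reals, Hd; lra. }
destruct (Rtotal_order w 0) as [Hneg | [-> | Hpos]].
- rewrite (Rabs_left w) in Hd' by easy.
  destruct (MVT_cor2 h dh w 0 Hneg) as [c [E Hc]].
  { intros v Hv; apply Hd'; rewrite Rabs_left1; lra. }
  replace (h w - h 0) with (dh c * w) by lra.
  apply H; [lra|]; rewrite !Rabs_left; lra.
- rewrite Rminus_diag, Rabs_R0; simpl; lra.
- rewrite (Rabs_right w) in Hd' by lra.
  destruct (MVT_cor2 h dh 0 w Hpos) as [c [E Hc]].
  { intros v Hv; apply Hd'; rewrite Rabs_right; lra. }
  replace (h w - h 0) with (dh c * w) by lra.
  apply H; [lra|]; rewrite !Rabs_right; lra.
Qed.

(** The recursion for the coefficients of [S^r] is the equality of the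
    coefficients of [w^n] in [S (w Q')] and [r (w S') Q]. *)
Lemma power_recurrence_convolution (a p : nat -> R) (r : R) (n : nat) :
  a 0%nat = 1 ->
  ((1 <= n)%nat -> INR n * p n =
     sum_n_m (fun k => (INR k * (1 + r) - INR n) * a k * p (n - k)%nat) 1 n) ->
  sum_n (fun k => a k * (INR (n - k) * p (n - k)%nat)) n =
  r * sum_n (fun k => INR k * a k * p (n - k)%nat) n.
Proof.
intros Ha H.
destruct n as [|n]; [rewrite !sum_n_0; simpl; ring|].
assert (E : sum_n (fun k => (INR k * (1 + r) - INR (S n)) * a k * p (S n - k)%nat)
              (S n) = 0).
{ rewrite sum_n_split_first, <- H by lia; rewrite Ha, Nat.sub_0_r.
  change (INR 0) with 0; real_eq; ring. }
match goal with |- ?x = ?y => replace y with (y + -1 * 0) by ring end.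
rewrite <- E, <- !sum_n_scal_l, <- sum_n_add.
apply sum_n_eq; intros k Hk; rewrite (minus_INR (S n) k) by easy; ring.
Qed.

(** [h = Q S^(-r)] has [h(0) = 1] and
    [w h' = S^(-r-1) (S (w Q') - r (w S') Q)].  The polynomial in the last
    factor has no terms of degree at most [N], so [h - 1 = O(w^(N+1))]; multiply
    by the bounded function [S^r]. *)
Lemma real_power_of_polynomial (a p : nat -> R) (r : R) (N : nat) :
  a 0%nat = 1 -> p 0%nat = 1 ->
  (forall n, (1 <= n <= N)%nat -> INR n * p n =
     sum_n_m (fun k => (INR k * (1 + r) - INR n) * a k * p (n - k)%nat) 1 n) ->
  exists C delta, 0 <= C /\ 0 < delta <= 1 /\ forall w, Rabs w <= delta ->
    Rabs (Rpower (poly a N w) r - poly p N w) <= C * Rabs w ^ S N.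
Proof.
intros Ha Hp Hrec.
destruct (poly_near_constant_term a N (/ 2)) as [delta [Hdelta Hnear]]; [lra|].
assert (Hpos : forall w, Rabs w <= delta -> / 2 <= poly a N w <= 2).
{ intros w Hw; specialize (Hnear w Hw); rewrite Ha in Hnear.
  apply Rabs_le_between in Hnear; lra. }
set (dh := fun w => poly_derivative p N w * Rpower (poly a N w) (- r) +
  poly p N w * (poly_derivative a N w *
                (- r * Rpower (poly a N w) (- r - 1)))).
set (h := fun w => poly p N w * Rpower (poly a N w) (- r)).
assert (Hh : forall w, Rabs w <= delta -> is_derive h w (dh w)).
{ intros w Hw; apply (is_derive_mult (poly p N)
    (fun v => Rpower (poly a N v) (- r))).
  - apply is_derive_poly.
  - apply (is_derive_comp (fun v => Rpower v (- r)) (poly a N)).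
    + apply is_derive_Reals, derivable_pt_lim_power; specialize (Hpos w Hw); lra.
    + apply is_derive_poly.
  - intros; apply Rmult_comm. }
set (C1 := sum_n (fun k => Rabs (a k)) N *
           sum_n (fun k => Rabs (INR k * p k)) N).
set (C2 := sum_n (fun k => Rabs (INR k * a k)) N *
           sum_n (fun k => Rabs (p k)) N).
set (K := Rpower 2 (Rabs (- r - 1)) * (C1 + Rabs r * C2)).
assert (HC1 : 0 <= C1) by (apply Rmult_le_pos; apply sum_n_abs_nonneg).
assert (HC2 : 0 <= C2) by (apply Rmult_le_pos; apply sum_n_abs_nonneg).
assert (HK : 0 <= K).
{ apply Rmult_le_pos; [left; apply exp_pos|].
  pose proof (Rmult_le_pos _ _ (Rabs_pos r) HC2); lra. }
assert (Hdh : forall w, Rabs w <= delta ->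
  Rabs (w * dh w) <= K * Rabs w ^ S N).
{ intros w Hw.
  assert (Hw1 : Rabs w <= 1) by lra.
  specialize (Hpos w Hw).
  assert (E : w * dh w = Rpower (poly a N w) (- r - 1) *
    (poly a N w * poly (fun k => INR k * p k) N w -
     r * (poly (fun k => INR k * a k) N w * poly p N w))).
  { rewrite <- !poly_derivative_euler; unfold dh.
    replace (Rpower (poly a N w) (- r))
      with (Rpower (poly a N w) (- r - 1) * poly a N w).
    - ring.
    - rewrite <- (Rpower_1 (poly a N w)) at 2 by lra.
      rewrite <- Rpower_plus; f_equal; ring. }
  rewrite E, Rabs_mult; unfold K; rewrite Rmult_assoc.
  apply Rmult_le_compat; try apply Rabs_pos.
  - rewrite Rabs_right by (apply Rle_ge; left; apply exp_pos).
    now apply Rpower_bounds.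
  - assert (B1 := poly_product a (fun k => INR k * p k) N w Hw1).
    assert (B2 := poly_product (fun k => INR k * a k) p N w Hw1).
    cbv beta in B1, B2.
    rewrite (poly_ext
      (fun n => sum_n (fun k => a k * (INR (n - k) * p (n - k)%nat)) n)
      (fun n => r *
        sum_n (fun k => INR k * a k * p (n - k)%nat) n)) in B1.
    2: { intros n Hn; apply power_recurrence_convolution; [easy|].
         intros Hn1; apply Hrec; lia. }
    rewrite (poly_scal r (fun n =>
      sum_n (fun k => INR k * a k * p (n - k)%nat) n)) in B1.
    set (q := poly (fun n =>
      sum_n (fun k => INR k * a k * p (n - k)%nat) n) N w) in *.
    replace (_ - _) with
      ((poly a N w * poly (fun k => INR k * p k) N w - r * q) +
       - (r * (poly (fun k => INR k * a k) N w * poly p N w - q))) by ring.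
    eapply Rle_trans; [apply Rabs_triang|].
    rewrite Rabs_Ropp, Rabs_mult, Rmult_plus_distr_r.
    apply Rplus_le_compat; [exact B1|].
    rewrite Rmult_assoc; apply Rmult_le_compat_l; [apply Rabs_pos | exact B2]. }
exists (Rpower 2 (Rabs r) * K), delta; repeat split; try easy.
{ apply Rmult_le_pos; [left; apply exp_pos | easy]. }
intros w Hw.
assert (G := growth_from_derivative h dh delta K N Hh Hdh HK w Hw).
assert (H0 : h 0 = 1).
{ unfold h; rewrite !poly_at_0, Ha, Hp; unfold Rpower.
  rewrite ln_1, Rmult_0_r, exp_0; ring. }
assert (E : Rpower (poly a N w) r - poly p N w =
  Rpower (poly a N w) r * - (h w - h 0)).
{ rewrite H0; unfold h; rewrite Rpower_Ropp; field.
  apply Rgt_not_eq, exp_pos. }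
rewrite E, Rabs_mult, Rabs_Ropp, Rmult_assoc.
apply Rmult_le_compat; try apply Rabs_pos; [|easy].
rewrite Rabs_right by (apply Rle_ge; left; apply exp_pos).
now apply Rpower_bounds, Hpos.
Qed.

(** The truncation order [L] of the base may exceed the order [N] of the
    expansion.  For the base [1 + w] this matters: its truncation at order [0]
    is [1], so the case [N = 0] needs [L = 1]. *)
Lemma real_powers_of_polynomial_uniform (a : nat -> R) (P : nat -> R -> R)
    (u : R) (L N : nat) :
  a 0%nat = 1 -> power_coefficients a P -> (N <= L)%nat ->
  exists C delta, 0 <= C /\ 0 < delta <= 1 /\
    forall w, Rabs w <= delta -> forall k, (k <= N)%nat ->
      Rabs (Rpower (poly a L w) (u - INR k) -
            poly (fun n => P n (u - INR k)) (N - k) w)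
      <= C * Rabs w ^ S (N - k).
Proof.
intros Ha HP HNL.
assert (Hone : forall k, exists C delta, 0 <= C /\ 0 < delta <= 1 /\
  forall w, Rabs w <= delta ->
      Rabs (Rpower (poly a L w) (u - INR k) -
            poly (fun n => P n (u - INR k)) (N - k) w)
      <= C * Rabs w ^ S (N - k)).
{ intros k; set (r := u - INR k).
  destruct (HP r) as [HP0 HPn].
  destruct (real_power_of_polynomial a (fun n => P n r) r L)
    as [C [delta [HC [Hdelta H]]]]; [easy | | |].
  - rewrite HP0, Ha; unfold Rpower; rewrite ln_1, Rmult_0_r; apply exp_0.
  - intros n Hn; rewrite (HPn n) by lia; rewrite Ha.
    field; apply not_0_INR; lia.
  - exists (C + sum_n (fun n => Rabs (P n r)) L), delta.
    pose proof (sum_n_abs_nonneg (fun n => P n r) L).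
    repeat split; try lra; intros w Hw.
    replace (_ - _) with
      ((Rpower (poly a L w) r - poly (fun n => P n r) L w) +
       (poly (fun n => P n r) L w - poly (fun n => P n r) (N - k) w)) by ring.
    eapply Rle_trans; [apply Rabs_triang|].
    rewrite Rmult_plus_distr_r; apply Rplus_le_compat.
    + eapply Rle_trans; [now apply H|].
      apply Rmult_le_compat_l; [easy | apply pow_abs_le; [lra | lia]].
    + apply poly_truncation; [lia | lra]. }
assert (Hmany : forall K, exists C delta, 0 <= C /\ 0 < delta <= 1 /\
  forall w, Rabs w <= delta -> forall k, (k <= K)%nat ->
      Rabs (Rpower (poly a L w) (u - INR k) -
            poly (fun n => P n (u - INR k)) (N - k) w)
      <= C * Rabs w ^ S (N - k)).
{ induction K as [|K [C1 [d1 [HC1 [Hd1 H1]]]]].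
  - destruct (Hone 0%nat) as [C [delta [HC [Hdelta H]]]].
    exists C, delta; repeat split; try easy.
    intros w Hw k Hk; replace k with 0%nat by lia; now apply H.
  - destruct (Hone (S K)) as [C2 [d2 [HC2 [Hd2 H2]]]].
    exists (C1 + C2), (Rmin d1 d2).
    assert (Hl := Rmin_l d1 d2); assert (Hr := Rmin_r d1 d2).
    assert (0 < Rmin d1 d2) by (apply Rmin_pos; lra).
    repeat split; try lra.
    intros w Hw k Hk.
    assert (Hp := pow_le (Rabs w) (S (N - k)) (Rabs_pos w)).
    destruct (Nat.eq_dec k (S K)) as [-> | Hk'].
    + eapply Rle_trans; [apply H2; lra|].
      apply Rmult_le_compat_r; [easy | lra].
    + eapply Rle_trans; [apply H1; [lra | lia]|].
      apply Rmult_le_compat_r; [easy | lra]. }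
apply Hmany.
Qed.

(** * Composition with the asymptotic expansion of [f] *)

Lemma expansion_bound (f : R -> R) (u : R) (b : nat -> R) (N : nat)
    (eps : R) :
  asymptotic_expansion f (fun x => Rpower x u) b -> 0 < eps ->
  exists X, 0 < X /\ forall y, X < y ->
    Rabs (f y - Rpower y u * poly b N (/ y)) <= eps * (Rpower y u * (/ y) ^ N).
Proof.
intros Hf Heps; destruct (Hf N (mkposreal eps Heps)) as [M HM].
exists (Rmax 1 M); split; [apply Rlt_le_trans with 1; [lra | apply Rmax_l]|].
intros y Hy.
assert (Hy1 := Rmax_l 1 M); assert (Hy2 := Rmax_r 1 M).
assert (H := HM y ltac:(lra)).
assert (E : poly b N (/ y) = sum_n (fun n => b n * / y ^ n) N).
{ apply sum_n_eq; intros n _; now rewrite pow_inv. }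
rewrite E, pow_inv.
eapply Rle_trans; [exact H|].
apply Rmult_le_compat_l; [simpl; lra|].
right; apply Rabs_right, Rle_ge, Rmult_le_pos; left;
  [apply exp_pos | apply Rinv_0_lt_compat, pow_lt; lra].
Qed.

Lemma truncated_expansion_scaled (b : nat -> R) (u : R) (N : nat) (x v : R) :
  0 < x -> 0 < v ->
  Rpower (x * v) u * poly b N (/ (x * v)) =
  Rpower x u *
    sum_n (fun k => b k * (/ x) ^ k * Rpower v (u - INR k)) N.
Proof.
intros Hx Hv; unfold poly; rewrite <- !sum_n_scal_l.
apply sum_n_eq; intros k _; rewrite Rpower_minus_INR, Rinv_mult, Rpow_mult_distr,
  <- Rpower_mult_distr by easy; real_eq; ring.
Qed.

(** Since [(x v)^(u-k) = x^u w^k v^(u-k)], the truncated expansion of [f] at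
    [x v] is a combination of powers of [v] to which
    [combination_of_expansions] applies.  The threshold [X] depends on the
    expansions of the powers of [v] only through their common constant [C]:
    this makes the estimate uniform when [v] and its coefficients [p] vary. *)
Lemma expansion_at_scaled_point (f : R -> R) (u : R) (b : nat -> R) (N : nat)
    (C eps : R) :
  asymptotic_expansion f (fun x => Rpower x u) b -> 0 < eps ->
  exists X, 0 < X /\ forall (x v : R) (p : nat -> nat -> R),
    X < x -> / 2 <= v <= 2 ->
    (forall k, (k <= N)%nat ->
       Rabs (Rpower v (u - INR k) - poly (p k) (N - k) (/ x))
       <= C * Rabs (/ x) ^ S (N - k)) ->
    Rabs (f (x * v) - Rpower x u *
          poly (fun n => sum_n (fun k => b k * p k (n - k)%nat) n) N (/ x))
    <= eps * (Rpower x u * (/ x) ^ N).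
Proof.
intros Hf Heps.
set (A := Rpower 2 (Rabs (u - INR N))).
assert (HA : 0 < A) by apply exp_pos.
destruct (expansion_bound f u b N (eps / 2 / A) Hf) as [X1 [HX1 H1]].
{ repeat apply Rdiv_lt_0_compat; lra. }
set (B := sum_n (fun k => Rabs (b k)) N * C).
exists (Rmax (2 * X1) (2 * B / eps)); split.
{ apply Rlt_le_trans with (2 * X1); [lra | apply Rmax_l]. }
intros x v p Hx Hv Hp.
assert (Hxl := Rmax_l (2 * X1) (2 * B / eps)).
assert (Hxr := Rmax_r (2 * X1) (2 * B / eps)).
assert (Hx0 : 0 < x) by lra.
assert (Hw : 0 < / x) by now apply Rinv_0_lt_compat.
assert (Hv0 : 0 < v) by lra.
assert (Hxv : X1 < x * v).
{ apply Rlt_le_trans with (x * / 2); [lra|].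
  apply Rmult_le_compat_l; lra. }
specialize (H1 _ Hxv).
rewrite truncated_expansion_scaled in H1 by easy.
assert (H2 := combination_of_expansions b p C
  (fun k => Rpower v (u - INR k)) N (/ x) Hp).
fold B in H2; rewrite (Rabs_right (/ x)) in H2 by lra.
set (G := sum_n _ N) in H1, H2.
set (q := poly _ N (/ x)) in H2 |- *.
assert (Hxu : 0 < Rpower x u) by apply exp_pos.
assert (HwN : 0 < (/ x) ^ N) by now apply pow_lt.
replace (f (x * v) - Rpower x u * q) with
  ((f (x * v) - Rpower x u * G) + Rpower x u * (G - q)) by ring.
eapply Rle_trans; [apply Rabs_triang|].
replace (eps * _) with
  (eps / 2 * (Rpower x u * (/ x) ^ N) + Rpower x u * (eps / 2 * (/ x) ^ N))
  by field.
apply Rplus_le_compat.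
- eapply Rle_trans; [exact H1|].
  rewrite Rinv_mult, Rpow_mult_distr, <- Rpower_mult_distr by easy.
  replace (_ * _) with
    (eps / 2 * (Rpower x u * (/ x) ^ N) * (/ A * (Rpower v u * (/ v) ^ N)))
    by (field; lra).
  rewrite <- Rmult_1_r.
  apply Rmult_le_compat_l.
  + apply Rmult_le_pos; [lra|]; apply Rmult_le_pos; lra.
  + rewrite <- Rpower_minus_INR by easy.
    apply (Rmult_le_reg_l A); [easy|].
    rewrite <- Rmult_assoc, Rinv_r, Rmult_1_l, Rmult_1_r by lra.
    now apply Rpower_bounds.
- rewrite Rabs_mult, (Rabs_right (Rpower x u)) by lra.
  apply Rmult_le_compat_l; [lra|].
  eapply Rle_trans; [exact H2|].
  simpl; rewrite <- Rmult_assoc; apply Rmult_le_compat_r; [lra|].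
  apply (Rmult_le_reg_r x); [easy|].
  rewrite Rmult_assoc, Rinv_l, Rmult_1_r by lra.
  apply (Rmult_le_reg_l (2 / eps)); [apply Rdiv_lt_0_compat; lra|].
  replace (2 / eps * B) with (2 * B / eps) by (field; lra).
  replace (2 / eps * (eps / 2 * x)) with x by (field; lra).
  lra.
Qed.

Definition one_plus_w (k : nat) : R :=
  match k with O => 1 | S O => 1 | _ => 0 end.

Lemma poly_one_plus_w (N : nat) (w : R) :
  poly one_plus_w (S N) w = 1 + w.
Proof.
induction N as [|N IH]; rewrite poly_S.
- rewrite poly_0; simpl; ring.
- rewrite IH; simpl; ring.
Qed.

(** For the series [1 + w] only the term [k = 1] of the recursion survives, and
    it reduces to [n binom(r,n) = (r - n + 1) binom(r,n-1)]. *)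
Lemma power_coefficients_gbinomial :
  power_coefficients one_plus_w (fun n r => gbinomial r n).
Proof.
intros r; split.
- unfold gbinomial, Rpower; simpl; rewrite ln_1, Rmult_0_r, exp_0; field.
- intros [|n] Hn; [lia|].
  assert (E : sum_n_m (fun k => (INR k * (1 + r) - INR (S n)) * one_plus_w k *
    gbinomial r (S n - k)) 1 (S n) = (r - INR n) * gbinomial r n).
  { rewrite sum_Sn_m by lia.
    rewrite (sum_n_m_ext_loc _ (fun _ => zero)).
    - rewrite sum_n_m_const_zero, plus_zero_r.
      change (one_plus_w 1) with 1; rewrite Nat.sub_succ, Nat.sub_0_r, (S_INR n).
      change (INR 1) with 1; real_eq; ring.
    - intros [|[|k]] Hk; [lia | lia |]; change zero with 0; simpl one_plus_w.
      real_eq; ring. }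
  rewrite E; unfold gbinomial.
  change (falling_factorial r (S n)) with (falling_factorial r n * (r - INR n)).
  rewrite fact_simpl, mult_INR; simpl (one_plus_w 0).
  field; split; [apply INR_fact_neq_0 | apply not_0_INR; lia].
Qed.

(** [x + z = x (1 + z w)], and [|z w|] is small uniformly for [|z| <= B]. *)
Lemma expansion_at_translated_point (f : R -> R) (u : R) (b : nat -> R)
    (N : nat) (B eps : R) :
  asymptotic_expansion f (fun x => Rpower x u) b -> 0 < eps -> 1 <= B ->
  exists X, 0 < X /\ forall x z, X < x -> Rabs z <= B ->
    Rabs (f (x + z) - Rpower x u *
      poly (fun n => sum_n (fun k => b k *
              (gbinomial (u - INR k) (n - k) * z ^ (n - k))) n) N (/ x))
    <= eps * (Rpower x u * (/ x) ^ N).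
Proof.
intros Hf Heps HB.
destruct (real_powers_of_polynomial_uniform one_plus_w
  (fun n r => gbinomial r n) u (S N) N) as [C [delta [HC [Hdelta H]]]];
  [easy | apply power_coefficients_gbinomial | lia |].
destruct (expansion_at_scaled_point f u b N (C * B ^ S N) eps Hf Heps)
  as [X [HX HXf]].
exists (Rmax X (Rmax (2 * B) (B / delta))); split.
{ apply Rlt_le_trans with X; [easy | apply Rmax_l]. }
intros x z Hx Hz.
assert (Hx1 : X < x) by (eapply Rle_lt_trans; [apply Rmax_l | exact Hx]).
assert (Hx2 : 2 * B < x).
{ eapply Rle_lt_trans; [|exact Hx].
  eapply Rle_trans; [apply Rmax_l | apply Rmax_r]. }
assert (Hx3 : B / delta < x).
{ eapply Rle_lt_trans; [|exact Hx].
  eapply Rle_trans; [apply Rmax_r | apply Rmax_r]. }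
assert (Hw : 0 < / x) by (apply Rinv_0_lt_compat; lra).
assert (Hzx : Rabs (z * / x) <= B * / x).
{ rewrite Rabs_mult, (Rabs_right (/ x)) by lra.
  apply Rmult_le_compat_r; lra. }
assert (Hzd : B * / x <= delta).
{ apply (Rmult_le_reg_r x); [lra|].
  rewrite Rmult_assoc, Rinv_l, Rmult_1_r by lra.
  apply (Rmult_le_reg_r (/ delta)); [apply Rinv_0_lt_compat; lra|].
  replace (delta * x * / delta) with x by (field; lra).
  unfold Rdiv in Hx3; lra. }
assert (Hzh : B * / x <= / 2).
{ apply (Rmult_le_reg_r x); [lra|].
  rewrite Rmult_assoc, Rinv_l, Rmult_1_r by lra; lra. }
replace (x + z) with (x * (1 + z * / x)) by (field; lra).
apply (HXf x (1 + z * / x) (fun k m => gbinomial (u - INR k) m * z ^ m)); [easy | |].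
- assert (H' := Rabs_le_between (z * / x) (/ 2)); lra.
- intros k Hk.
  assert (Hb := H (z * / x) ltac:(lra) k Hk).
  rewrite poly_one_plus_w in Hb.
  replace (poly (fun m => gbinomial (u - INR k) m * z ^ m) (N - k) (/ x))
    with (poly (fun m => gbinomial (u - INR k) m) (N - k) (z * / x)).
  2: { apply sum_n_eq; intros m _; rewrite Rpow_mult_distr; real_eq; ring. }
  eapply Rle_trans; [exact Hb|].
  rewrite Rmult_assoc; apply Rmult_le_compat_l; [easy|].
  rewrite Rabs_mult, Rpow_mult_distr.
  apply Rmult_le_compat_r; [apply pow_le, Rabs_pos|].
  apply Rle_trans with (B ^ S (N - k)).
  + apply pow_incr; split; [apply Rabs_pos | easy].
  + apply Rle_pow; [easy | lia].
Qed.

(** * The integral mean *)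

Lemma continuous_at_large_points (D : R -> Prop) (f : R -> R) (M y : R) :
  continuous_on D f -> (forall x, M < x -> D x) -> M < y -> continuous f y.
Proof.
intros Hf HD Hy P HP.
assert (H := Hf y (HD y Hy) P HP).
unfold filtermap, within in *.
assert (HM : locally y (fun z => M < z)) by (apply open_gt; exact Hy).
generalize (filter_and _ _ H HM); apply filter_imp.
intros z [H1 H2]; auto.
Qed.

(** The intermediate point comes from the mean value theorem applied to
    [y |-> RInt f A y]; strict monotonicity makes it the only preimage of the
    mean, so the description operator in [inverse_on] selects it. *)
Lemma integral_mean_spec (D : R -> Prop) (f : R -> R) (M A B : R) :
  strictly_monotone_on D f -> continuous_on D f ->
  (forall x, M < x -> D x) -> M < A -> A < B ->
  A <= integral_mean D f A B <= B /\
  f (integral_mean D f A B) = / (B - A) * RInt f A B.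
Proof.
intros Hmon Hf HD HA HAB.
assert (Hc : forall y, M < y -> continuous f y).
{ intros y; now apply (continuous_at_large_points D). }
assert (Hd : forall y, A <= y -> is_derive (fun y => RInt f A y) y (f y)).
{ intros y Hy; apply is_derive_RInt with A; [|apply Hc; lra].
  assert (HM : locally y (fun z => M < z)) by (apply open_gt; lra).
  revert HM; apply filter_imp; intros z Hz.
  apply (RInt_correct f), ex_RInt_continuous; intros v Hv; apply Hc.
  eapply Rlt_le_trans; [|apply Hv]; now apply Rmin_glb_lt. }
destruct (MVT_gen (fun y => RInt f A y) A B f) as [c [Hcb E]].
{ intros y; rewrite Rmin_left, Rmax_right by lra; intros; apply Hd; lra. }
{ intros y; rewrite Rmin_left, Rmax_right by lra; intros.
  apply continuity_pt_filterlim, (ex_derive_continuous (fun y => RInt f A y)).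
  eexists; apply Hd; lra. }
rewrite Rmin_left, Rmax_right in Hcb by lra.
rewrite RInt_point in E.
assert (Hc' : f c = / (B - A) * RInt f A B).
{ replace (RInt f A B) with (f c * (B - A)).
  - field; lra.
  - rewrite <- E; unfold zero; simpl; ring. }
replace (integral_mean D f A B) with c; [easy|].
symmetry; unfold integral_mean, inverse_on; rewrite <- Hc'.
apply (iota_unique (fun x => D x /\ f x = f c)).
- intros y [Dy Ey].
  assert (Dc : D c) by (apply HD; lra).
  destruct (Rtotal_order y c) as [H | [H | H]]; [|easy|];
    destruct Hmon as [Hm | Hm]; apply Hm in H; try easy; lra.
- split; [apply HD; lra | easy].
Qed.

Lemma is_RInt_sum_n (g : nat -> R -> R) (l : nat -> R) (A B : R) (N : nat) :
  (forall n, (n <= N)%nat -> is_RInt (g n) A B (l n)) ->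
  is_RInt (fun y => sum_n (fun n => g n y) N) A B (sum_n l N).
Proof.
induction N as [|N IH]; intros H.
- rewrite sum_n_0; apply (is_RInt_ext (g 0%nat)); [|now apply H].
  intros; now rewrite sum_n_0.
- rewrite sum_n_S.
  apply (is_RInt_ext (fun y => plus (sum_n (fun n => g n y) N) (g (S N) y))).
  + intros y _; now rewrite sum_n_S.
  + apply (is_RInt_plus (fun y => sum_n (fun n => g n y) N)); [|now apply H].
    apply IH; intros; apply H; lia.
Qed.

Lemma is_RInt_translated_pow (x s t : R) (m : nat) :
  is_RInt (fun y => (y - x) ^ m) (x + s) (x + t)
    ((t ^ S m - s ^ S m) / INR (S m)).
Proof.
replace ((t ^ S m - s ^ S m) / INR (S m)) with
  (minus ((x + t - x) ^ S m / INR (S m)) ((x + s - x) ^ S m / INR (S m))).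
2: { unfold minus, plus, opp; simpl plus.
     replace (x + t - x) with t by ring; replace (x + s - x) with s by ring.
     simpl; unfold Rdiv; ring. }
apply (is_RInt_derive (fun y => (y - x) ^ S m / INR (S m))).
- intros y _; auto_derive; [easy|].
  change (pred (S m)) with m.
  change (match m with O => 1 | S _ => INR m + 1 end) with (INR (S m)).
  change (y + - x) with (y - x).
  field; apply not_0_INR; lia.
- intros y _; apply (ex_derive_continuous (fun y => (y - x) ^ m)); auto_derive; easy.
Qed.

(** With [y = x + z], the uniform approximation [g] of [f] on [[x+s,x+t]] is a
    polynomial in [y - x], and its integral is computed term by term. *)
Lemma mean_expansion (D : R -> Prop) (f : R -> R) (u : R) (b : nat -> R)
    (s t M : R) (N : nat) (eps : R) :
  continuous_on D f -> (forall x, M < x -> D x) ->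
  asymptotic_expansion f (fun x => Rpower x u) b -> s < t -> 0 < eps ->
  exists X, 0 < X /\ forall x, X < x ->
    Rabs (/ (t - s) * RInt f (x + s) (x + t) -
          Rpower x u * poly (mean_coefficient u b s t) N (/ x))
    <= eps * (Rpower x u * (/ x) ^ N).
Proof.
intros Hc HD Hf Hst Heps.
set (B := 1 + Rabs s + Rabs t).
assert (Hs := Rabs_pos s); assert (Ht := Rabs_pos t).
destruct (expansion_at_translated_point f u b N B eps Hf Heps)
  as [X [HX H]]; [unfold B; lra|].
exists (Rmax X (M - s)); split.
{ apply Rlt_le_trans with X; [easy | apply Rmax_l]. }
intros x Hx.
assert (Hx1 := Rmax_l X (M - s)); assert (Hx2 := Rmax_r X (M - s)).
set (g := fun y => Rpower x u *
      poly (fun n => sum_n (fun k => b k *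
              (gbinomial (u - INR k) (n - k) * (y - x) ^ (n - k))) n) N (/ x)).
assert (Hg : is_RInt g (x + s) (x + t)
  ((t - s) * (Rpower x u * poly (mean_coefficient u b s t) N (/ x)))).
{ replace (_ * _) with (Rpower x u *
    sum_n (fun n => (/ x) ^ n * sum_n (fun k =>
       b k * gbinomial (u - INR k) (n - k) *
            ((t ^ S (n - k) - s ^ S (n - k)) / INR (S (n - k)))) n) N).
  2: { rewrite <- Rmult_assoc, (Rmult_comm (t - s)), Rmult_assoc; f_equal.
       unfold poly; rewrite <- sum_n_scal_l; apply sum_n_eq; intros n _.
       rewrite <- Rmult_assoc, (Rmult_comm (_ * _) ((/ x) ^ n)); f_equal.
       unfold mean_coefficient; rewrite <- sum_n_scal_l.
       apply sum_n_eq; intros k Hk.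
       replace (n + 1 - k)%nat with (S (n - k)) by lia.
       field; split; [lra | apply not_0_INR; lia]. }
  apply (is_RInt_ext (fun y => Rpower x u *
    sum_n (fun n => (/ x) ^ n * sum_n (fun k =>
       b k * gbinomial (u - INR k) (n - k) * (y - x) ^ (n - k)) n) N)).
  - intros y _; unfold g; f_equal.
    unfold poly; apply sum_n_eq; intros n _; rewrite Rmult_comm; f_equal.
    apply sum_n_eq; intros k _; real_eq; ring.
  - apply (is_RInt_scal (V := R_NormedModule)).
    apply (is_RInt_sum_n (fun n y => (/ x) ^ n * sum_n (fun k =>
       b k * gbinomial (u - INR k) (n - k) * (y - x) ^ (n - k)) n)).
    intros n _; apply (is_RInt_scal (V := R_NormedModule)).
    apply (is_RInt_sum_n (fun k y =>
       b k * gbinomial (u - INR k) (n - k) * (y - x) ^ (n - k))).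
    intros k _; apply (is_RInt_scal (V := R_NormedModule)).
    apply is_RInt_translated_pow. }
assert (Hex : ex_RInt f (x + s) (x + t)).
{ apply (ex_RInt_continuous (V := R_CompleteNormedModule)).
  intros y; rewrite Rmin_left, Rmax_right by lra.
  intros Hy; apply (continuous_at_large_points D f M); [easy | easy | lra]. }
set (Q := Rpower x u * poly (mean_coefficient u b s t) N (/ x)) in Hg |- *.
assert (Hd := is_RInt_minus _ _ _ _ _ _ (RInt_correct f _ _ Hex) Hg).
assert (Hfg : forall y, x + s <= y <= x + t ->
  Rabs (f y - g y) <= eps * (Rpower x u * (/ x) ^ N)).
{ intros y Hy; unfold g; replace (f y) with (f (x + (y - x)))
    by (f_equal; ring).
  apply H; [lra|]; unfold B; apply Rabs_le.
  assert (Hs' := Rle_abs (- s)); assert (Ht' := Rle_abs t).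
  rewrite Rabs_Ropp in Hs'; lra. }
assert (Hxst : x + s <= x + t) by lra.
assert (Hle := norm_RInt_le_const (V := R_NormedModule) _ _ _ _ _
  Hxst Hfg Hd).
replace (x + t - (x + s)) with (t - s) in Hle by ring.
apply (Rmult_le_reg_l (t - s)); [lra|].
rewrite <- (Rabs_right (t - s)) at 1 by lra; rewrite <- Rabs_mult.
replace ((t - s) * (/ (t - s) * RInt f (x + s) (x + t) - Q)) with
  (RInt f (x + s) (x + t) - (t - s) * Q) by (field; lra).
exact Hle.
Qed.

(** * Inverting [f] asymptotically *)

Lemma is_derive_truncated_expansion (b : nat -> R) (u : R) (N : nat) (y : R) :
  0 < y ->
  is_derive (fun y => Rpower y u * poly b N (/ y)) y
    (Rpower y (u - 1) * poly (fun k => (u - INR k) * b k) N (/ y)).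
Proof.
intros Hy.
replace (_ * _) with
  (u * Rpower y (u - 1) * poly b N (/ y) +
   Rpower y u * (- / y ^ 2 * poly_derivative b N (/ y))).
- apply (is_derive_mult (fun y => Rpower y u) (fun y => poly b N (/ y))).
  + now apply is_derive_Reals, derivable_pt_lim_power.
  + apply (is_derive_comp (poly b N) (fun y => / y)).
    * apply is_derive_poly.
    * auto_derive; [lra | field; lra].
  + intros; apply Rmult_comm.
- replace (poly (fun k => (u - INR k) * b k) N (/ y)) with
    (u * poly b N (/ y) + -1 * (/ y * poly_derivative b N (/ y))).
  + replace (Rpower y u) with (Rpower y (u - 1) * y).
    * field; lra.
    * rewrite <- (Rpower_1 y) at 2 by easy.
      rewrite <- Rpower_plus; f_equal; ring.
  + rewrite poly_derivative_euler; unfold poly.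
    rewrite <- !sum_n_scal_l, <- sum_n_add; apply sum_n_eq; intros.
    real_eq; ring.
Qed.

(** [f] is replaced by its truncated expansion [G], at the cost of an error
    [o(x^(u-N))].  For large [x] the derivative [G'] is at least [m x^(u-1)]
    in absolute value on [[x/2,2x]], where [m] is half of [|u b_0|] times the
    smallest value of [v^(u-1)] for [v] between [1/2] and [2]. *)
Lemma close_values_imply_close_points (f : R -> R) (u : R) (b : nat -> R)
    (N : nat) (eps : R) :
  asymptotic_expansion f (fun x => Rpower x u) b ->
  u <> 0 -> b 0%nat <> 0 -> 0 < eps ->
  exists eta X, 0 < eta /\ 0 < X /\ forall x v1 v2, X < x ->
    / 2 <= v1 <= 2 -> / 2 <= v2 <= 2 ->
    Rabs (f (x * v1) - f (x * v2)) <= eta * (Rpower x u * (/ x) ^ N) ->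
    Rabs (x * v1 - x * v2) <= eps * (x * (/ x) ^ N).
Proof.
intros Hf Hu Hb Heps.
assert (Hub : 0 < Rabs (u * b 0%nat) / 2).
{ apply Rdiv_lt_0_compat; [|lra].
  now apply Rabs_pos_lt, Rmult_integral_contrapositive. }
set (A := Rpower 2 (Rabs (u - INR N))).
set (m := Rpower 2 (- Rabs (u - 1)) * (Rabs (u * b 0%nat) / 2)).
assert (HA : 0 < A) by apply exp_pos.
assert (Hm : 0 < m) by (apply Rmult_lt_0_compat; [apply exp_pos | easy]).
assert (Hmeps : 0 < m * eps) by now apply Rmult_lt_0_compat.
destruct (expansion_bound f u b N (m * eps / 4 / A) Hf) as [X1 [HX1 H1]].
{ repeat apply Rdiv_lt_0_compat; lra. }
destruct (poly_near_constant_term (fun k => (u - INR k) * b k) N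
  (Rabs (u * b 0%nat) / 2) Hub) as [delta [Hdelta H2]].
set (G := fun y => Rpower y u * poly b N (/ y)).
(* [eta] takes half of the admissible error [m * eps]; the replacement of [f]
   by [G] at the two points takes a quarter each. *)
exists (m * eps / 2), (Rmax (2 * X1) (2 / delta)).
split; [lra|]; split.
{ apply Rlt_le_trans with (2 * X1); [lra | apply Rmax_l]. }
intros x v1 v2 Hx Hv1 Hv2 Hfv.
assert (Hxl := Rmax_l (2 * X1) (2 / delta)).
assert (Hxr := Rmax_r (2 * X1) (2 / delta)).
assert (Hx0 : 0 < x) by lra.
assert (Hw : 0 < / x) by now apply Rinv_0_lt_compat.
assert (Hxu : 0 < Rpower x u) by apply exp_pos.
assert (HwN : 0 < (/ x) ^ N) by now apply pow_lt.
assert (Herr : forall v, / 2 <= v <= 2 ->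
  Rabs (f (x * v) - G (x * v)) <= m * eps / 4 * (Rpower x u * (/ x) ^ N)).
{ intros v Hv.
  assert (Hxv : X1 < x * v).
  { apply Rlt_le_trans with (x * / 2); [lra|].
    apply Rmult_le_compat_l; lra. }
  eapply Rle_trans; [now apply H1|].
  rewrite Rinv_mult, Rpow_mult_distr, <- Rpower_mult_distr by lra.
  replace (_ * _) with
    (m * eps / 4 * (Rpower x u * (/ x) ^ N) * (/ A * (Rpower v u * (/ v) ^ N)))
    by (field; lra).
  rewrite <- Rmult_1_r.
  apply Rmult_le_compat_l.
  + apply Rmult_le_pos; [lra|]; apply Rmult_le_pos; lra.
  + rewrite <- Rpower_minus_INR by lra.
    apply (Rmult_le_reg_l A); [easy|].
    rewrite <- Rmult_assoc, Rinv_r, Rmult_1_l, Rmult_1_r by lra.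
    now apply Rpower_bounds. }
assert (HG : Rabs (G (x * v1) - G (x * v2)) <=
  m * eps * (Rpower x u * (/ x) ^ N)).
{ replace (G (x * v1) - G (x * v2)) with
    (- (f (x * v1) - G (x * v1)) +
     ((f (x * v1) - f (x * v2)) + (f (x * v2) - G (x * v2)))) by ring.
  eapply Rle_trans; [apply Rabs_triang|].
  rewrite Rabs_Ropp.
  assert (T := Rabs_triang (f (x * v1) - f (x * v2)) (f (x * v2) - G (x * v2))).
  assert (E1 := Herr v1 Hv1); assert (E2 := Herr v2 Hv2); lra. }
set (dG := fun y => Rpower y (u - 1) * poly (fun k => (u - INR k) * b k) N (/ y)).
assert (Hpos : forall y, x * / 2 <= y -> is_derive G y (dG y)).
{ intros y Hy; apply is_derive_truncated_expansion; lra. }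
assert (Hmin : x * / 2 <= Rmin (x * v2) (x * v1)).
{ apply Rmin_glb; apply Rmult_le_compat_l; lra. }
assert (Hmax : Rmax (x * v2) (x * v1) <= x * 2).
{ apply Rmax_lub; apply Rmult_le_compat_l; lra. }
destruct (MVT_gen G (x * v2) (x * v1) dG) as [y [Hy E]].
{ intros y Hy; apply Hpos; lra. }
{ intros y Hy; apply continuity_pt_filterlim, (ex_derive_continuous G).
  eexists; apply Hpos; lra. }
assert (HdG : m * Rpower x (u - 1) <= Rabs (dG y)).
{ unfold dG; rewrite Rabs_mult, (Rabs_right (Rpower y _))
    by (apply Rle_ge; left; apply exp_pos).
  replace y with (x * (y / x)) at 1 by (field; lra).
  assert (Hyx : / 2 <= y / x <= 2).
  { split; apply (Rmult_le_reg_r x); try easy; unfold Rdiv;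
      rewrite Rmult_assoc, Rinv_l, Rmult_1_r by lra; lra. }
  rewrite <- Rpower_mult_distr by lra.
  unfold m; rewrite (Rmult_comm _ (Rpower x (u - 1))), <- Rmult_assoc.
  apply Rmult_le_compat.
  - apply Rmult_le_pos; left; apply exp_pos.
  - lra.
  - apply Rmult_le_compat_l; [left; apply exp_pos | now apply Rpower_bounds].
  - assert (Hy0 : 0 < y) by lra.
    assert (Hd := H2 (/ y)); change (INR 0) with 0 in Hd.
    rewrite Rminus_0_r in Hd.
    assert (Hyd : Rabs (/ y) <= delta).
    { rewrite Rabs_right by (apply Rle_ge; left; now apply Rinv_0_lt_compat).
      apply (Rmult_le_reg_r y); [easy|]; rewrite Rinv_l by lra.
      apply Rle_trans with (delta * (2 / delta * / 2)).
      - right; field; lra.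
      - apply Rmult_le_compat_l; lra. }
    specialize (Hd Hyd).
    assert (T := Rabs_triang_inv (u * b 0%nat)
      (u * b 0%nat - poly (fun k => (u - INR k) * b k) N (/ y))).
    replace (u * b 0%nat - (u * b 0%nat - _)) with
      (poly (fun k => (u - INR k) * b k) N (/ y)) in T by ring.
    rewrite (Rabs_minus_sym (u * b 0%nat)) in T; lra. }
rewrite E, Rabs_mult in HG.
assert (Hxu1 : 0 < Rpower x (u - 1)) by apply exp_pos.
apply (Rmult_le_reg_l (m * Rpower x (u - 1))).
{ now apply Rmult_lt_0_compat. }
eapply Rle_trans; [apply Rmult_le_compat_r; [apply Rabs_pos | exact HdG]|].
eapply Rle_trans; [exact HG|].
right; replace (Rpower x u) with (Rpower x (u - 1) * x); [ring|].
rewrite <- (Rpower_1 x) at 2 by easy.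
rewrite <- Rpower_plus; f_equal; ring.
Qed.

(** * The recursively defined coefficients *)

(** Every coefficient depends on all the earlier ones, so the recursion carries
    the whole initial segment of the sequence, extended by [0]. *)
Fixpoint prefix (step : nat -> (nat -> R) -> R) (n : nat) : nat -> R :=
  match n with
  | O => fun _ => 0
  | S m => fun k =>
      if Nat.eqb k m then step m (prefix step m) else prefix step m k
  end.

Definition course_of_values (step : nat -> (nat -> R) -> R) (n : nat) : R :=
  prefix step (S n) n.

Lemma prefix_correct (step : nat -> (nat -> R) -> R) (n k : nat) :
  (k < n)%nat -> prefix step n k = course_of_values step k.
Proof.
intros H; induction H as [|n H IH]; [easy|].
simpl; destruct (Nat.eqb_spec k n); [lia | easy].
Qed.

Lemma course_of_values_eq (step : nat -> (nat -> R) -> R) (n : nat) :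
  (forall g h, (forall k, (k < n)%nat -> g k = h k) -> step n g = step n h) ->
  course_of_values step n = step n (course_of_values step).
Proof.
intros Hstep; unfold course_of_values at 1; simpl; rewrite Nat.eqb_refl.
apply Hstep; intros k Hk; now apply prefix_correct.
Qed.

Definition power_step (a : nat -> R) (r : R) (n : nat) (p : nat -> R) : R :=
  match n with
  | O => Rpower (a 0%nat) r
  | S _ =>
    1 / (INR n * a 0%nat) *
    sum_n_m (fun k => (INR k * (1 + r) - INR n) * a k * p (n - k)%nat) 1 n
  end.

Definition power_coefficient (a : nat -> R) (n : nat) (r : R) : R :=
  course_of_values (power_step a r) n.

Lemma power_coefficient_eq (a : nat -> R) (n : nat) (r : R) :
  power_coefficient a n r =
  power_step a r n (fun m => power_coefficient a m r).
Proof.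
apply (course_of_values_eq (power_step a r)); intros g h H.
destruct n as [|n]; [easy|]; unfold power_step; f_equal.
apply sum_n_m_ext_loc; intros k Hk; f_equal; apply H; lia.
Qed.

Lemma power_coefficient_spec (a : nat -> R) :
  power_coefficients a (power_coefficient a).
Proof.
intros r; split.
- now rewrite power_coefficient_eq.
- intros [|n] Hn; [lia|]; now rewrite power_coefficient_eq.
Qed.

(** [P_n(r)] depends only on [a_0, ..., a_n].  The recursion for [a_n] calls
    [P_m] with [m < n] only, and is therefore well founded. *)
Lemma power_coefficient_ext (a a' : nat -> R) (r : R) (n : nat) :
  (forall k, (k <= n)%nat -> a k = a' k) ->
  power_coefficient a n r = power_coefficient a' n r.
Proof.
induction n as [n IH] using (well_founded_induction Wf_nat.lt_wf); intros H.
rewrite !power_coefficient_eq; destruct n as [|n]; unfold power_step.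
- now rewrite H.
- rewrite <- (H 0%nat) by lia; f_equal.
  apply sum_n_m_ext_loc; intros k Hk; rewrite H, IH; [easy | lia | | lia].
  intros j Hj; apply H; lia.
Qed.

Definition coefficient_step (u : R) (b : nat -> R) (s t : R) (n : nat)
    (a : nat -> R) : R :=
  match n with
  | O => 1
  | S _ =>
    - (1 / (b 0%nat * u)) *
    (sum_n_m (fun j => b j * power_coefficient a (n - j) (u - INR j)) 1 n +
     b 0%nat / INR n *
       sum_n_m (fun k => (INR k * (1 + u) - INR n) * a k *
                         power_coefficient a (n - k) u) 1 (n - 1) -
     mean_coefficient u b s t n)
  end.

Definition integral_mean_coefficient (u : R) (b : nat -> R) (s t : R) :
    nat -> R :=
  course_of_values (coefficient_step u b s t).

Lemma integral_mean_coefficient_eq (u : R) (b : nat -> R) (s t : R) (n : nat) :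
  integral_mean_coefficient u b s t n =
  coefficient_step u b s t n (integral_mean_coefficient u b s t).
Proof.
apply course_of_values_eq; intros g h H.
destruct n as [|n]; [easy|]; unfold coefficient_step; do 2 f_equal; f_equal.
- apply sum_n_m_ext_loc; intros k Hk; f_equal.
  apply power_coefficient_ext; intros j Hj; apply H; lia.
- f_equal; apply sum_n_m_ext_loc; intros k Hk; rewrite H by lia; f_equal.
  apply power_coefficient_ext; intros j Hj; apply H; lia.
Qed.

(** The left-hand side is [b_0 P_n(u)] plus the terms with [k >= 1].  In the
    recursion for [P_n(u)] the last summand, [k = n], is [n u a_n P_0(u)]:
    it is the only place where [a_n] occurs, and solving for [a_n] gives its
    recursion. *)
Lemma composition_coefficient (a : nat -> R) (P : nat -> R -> R) (u : R)
    (b : nat -> R) (s t : R) (n : nat) :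
  u <> 0 -> b 0%nat <> 0 -> s < t ->
  power_coefficients a P -> a 0%nat = 1 ->
  ((1 <= n)%nat ->
      a n =
        - (1 / (b 0%nat * u)) *
        (sum_n_m (fun j => b j * P (n - j)%nat (u - INR j)) 1 n +
         b 0%nat / INR n *
           sum_n_m (fun k => (INR k * (1 + u) - INR n) * a k * P (n - k)%nat u)
             1 (n - 1) -
         mean_coefficient u b s t n)) ->
  sum_n (fun k => b k * P (n - k)%nat (u - INR k)) n =
  mean_coefficient u b s t n.
Proof.
intros Hu Hb Hst HP Ha Hrec.
assert (HP0 : forall r, P 0%nat r = 1).
{ intros r; rewrite (proj1 (HP r)), Ha; unfold Rpower.
  rewrite ln_1, Rmult_0_r; apply exp_0. }
destruct n as [|n].
- unfold mean_coefficient; rewrite !sum_n_0, HP0; unfold gbinomial; simpl.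
  field; lra.
- rewrite sum_n_split_first; change (INR 0) with 0.
  rewrite Nat.sub_0_r, Rminus_0_r, (proj2 (HP u) (S n)) by lia; rewrite Ha.
  specialize (Hrec ltac:(lia)); rewrite Nat.sub_succ, Nat.sub_0_r in Hrec.
  rewrite sum_n_Sm by lia; rewrite Nat.sub_diag, HP0.
  set (V := sum_n_m _ 1 (S n) : R) in Hrec |- *.
  set (T := sum_n_m _ 1 n : R) in Hrec |- *.
  assert (Hn : INR (S n) <> 0) by (apply not_0_INR; lia).
  set (q := INR (S n)) in *.
  change (b 0%nat * (1 / (q * 1) * (T + (q * (1 + u) - q) * a (S n) * 1)) + V =
    mean_coefficient u b s t (S n)).
  rewrite Hrec; field; easy.
Qed.

Theorem theorem3p1 (D : R -> Prop) (f : R -> R) (u : R) (b : nat -> R)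
    (s t : R)
    (D_interval : is_interval D)
    (D_infty : Rbar_locally p_infty D)
    (f_monotone : strictly_monotone_on D f)
    (f_continuous : continuous_on D f)
    (u_neq0 : u <> 0)
    (b0_neq0 : b 0%nat <> 0)
    (f_expansion : asymptotic_expansion f (fun x => Rpower x u) b)
    (lt_st : s < t) :
  exists (a : nat -> R) (P : nat -> R -> R),
    asymptotic_expansion (fun x => integral_mean D f (x + s) (x + t))
      (fun x => x) a /\
    power_coefficients a P /\
    a 0%nat = 1 /\
    forall n : nat, (1 <= n)%nat ->
      a n =
        - (1 / (b 0%nat * u)) *
        (sum_n_m (fun j => b j * P (n - j)%nat (u - INR j)) 1 n +
         b 0%nat / INR n *
           sum_n_m (fun k => (INR k * (1 + u) - INR n) * a k * P (n - k)%nat u)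
             1 (n - 1) -
         mean_coefficient u b s t n).
Proof.
set (a := integral_mean_coefficient u b s t).
assert (HP := power_coefficient_spec a).
set (P := power_coefficient a) in HP.
assert (Ha : a 0%nat = 1) by reflexivity.
assert (Hrec : forall n : nat, (1 <= n)%nat ->
      a n =
        - (1 / (b 0%nat * u)) *
        (sum_n_m (fun j => b j * P (n - j)%nat (u - INR j)) 1 n +
         b 0%nat / INR n *
           sum_n_m (fun k => (INR k * (1 + u) - INR n) * a k * P (n - k)%nat u)
             1 (n - 1) -
         mean_coefficient u b s t n)).
{ intros [|n] Hn; [lia|].
  exact (integral_mean_coefficient_eq u b s t (S n)). }
exists a, P; repeat split; try easy; try apply HP.
intros N [eps Heps]; simpl pos.
destruct D_infty as [M HM].
destruct (close_values_imply_close_points f u b N eps)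
  as [eta [X1 [Heta [HX1 Hclose]]]]; try easy.
destruct (mean_expansion D f u b s t M N (eta / 2)) as [X2 [HX2 Hmean]];
  try easy; [lra|].
destruct (real_powers_of_polynomial_uniform a P u N N)
  as [C [d1 [HC [Hd1 Hpow]]]]; try easy.
destruct (expansion_at_scaled_point f u b N C (eta / 2))
  as [X3 [HX3 Hcomp]]; try easy; [lra|].
destruct (poly_near_constant_term a N (/ 2)) as [d2 [Hd2 Hnear]]; [lra|].
set (B := 1 + Rabs s + Rabs t).
assert (Hs := Rabs_pos s); assert (Ht := Rabs_pos t).
assert (Hs1 := Rle_abs (- s)); assert (Ht1 := Rle_abs t).
rewrite Rabs_Ropp in Hs1.
assert (Hd1' : 0 < / d1) by (apply Rinv_0_lt_compat; lra).
assert (Hd2' : 0 < / d2) by (apply Rinv_0_lt_compat; lra).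
exists (X1 + X2 + X3 + Rabs M + 2 * B + / d1 + / d2).
intros x Hx.
assert (HMM := Rle_abs M); assert (HM0 := Rabs_pos M).
unfold B in Hx.
assert (Hx0 : 0 < x) by lra.
destruct (integral_mean_spec D f M (x + s) (x + t)) as [Hloc Hval];
  try easy; try lra.
set (theta := integral_mean D f (x + s) (x + t)) in *.
replace (x + t - (x + s)) with (t - s) in Hval by ring.
assert (Hw0 : 0 < / x) by now apply Rinv_0_lt_compat.
assert (Hsmall : forall d, 0 < d -> / d < x -> Rabs (/ x) <= d).
{ intros d Hd Hdx; rewrite Rabs_right by lra; left.
  rewrite <- (Rinv_inv d); apply Rinv_lt_contravar; [|easy].
  apply Rmult_lt_0_compat; [now apply Rinv_0_lt_compat | easy]. }
(* [x v1] is the mean and [x v2] its truncated expansion. *)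
set (v1 := theta / x); set (v2 := poly a N (/ x)).
assert (Ev1 : x * v1 = theta) by (unfold v1; field; lra).
assert (Hv1 : / 2 <= v1 <= 2).
{ split; apply (Rmult_le_reg_l x); try easy; rewrite Ev1; lra. }
assert (Hv2 : / 2 <= v2 <= 2).
{ assert (Hn := Hnear (/ x) (Hsmall d2 ltac:(lra) ltac:(lra))).
  fold v2 in Hn; rewrite Ha in Hn; apply Rabs_le_between in Hn; lra. }
assert (Hf1 := Hmean x ltac:(lra)).
assert (Hf2 := Hcomp x v2 (fun k m => P m (u - INR k)) ltac:(lra) Hv2
  (Hpow (/ x) (Hsmall d1 ltac:(lra) ltac:(lra)))).
rewrite (poly_ext _ (mean_coefficient u b s t)) in Hf2.
2: { intros n _; apply (composition_coefficient a); try easy; now apply Hrec. }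
rewrite <- Hval, <- Ev1 in Hf1.
assert (Hfin : Rabs (x * v1 - x * v2) <= eps * (x * (/ x) ^ N)).
{ apply Hclose; try easy; [lra|].
  set (Y := Rpower x u * poly (mean_coefficient u b s t) N (/ x)) in *.
  replace (f (x * v1) - f (x * v2)) with
    ((f (x * v1) - Y) + - (f (x * v2) - Y)) by ring.
  eapply Rle_trans; [apply Rabs_triang|].
  rewrite Rabs_Ropp; lra. }
rewrite Ev1 in Hfin.
replace (sum_n (fun n => a n * / x ^ n) N) with v2.
2: { apply sum_n_eq; intros n _; now rewrite pow_inv. }
eapply Rle_trans; [exact Hfin|].
rewrite <- pow_inv; apply Rmult_le_compat_l; [lra | apply Rle_abs].
Qed.
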